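(* For each integer $k\geq 2$ and each integer $n\geq\binom{k}{2}+2k$, we have \[\operatorname{sum}\bigl(\hat{K}_n^{(k,k)}\bigr)= 2n-2k-1\] and \[\operatorname{dif}\bigl(\hat{K}_n^{(k,k)}\bigr)\geq n-\frac{2k}{3}-1=\Bigl\lceil \operatorname{sum}\bigl(\hat{K}_n^{(k,k)}\bigr)/2\Bigr\rceil+\frac{k}{3}-1.\]
   Context: For a finite simple graph $G$ and an injective labelling $f:V(G)\to\mathbb{Z}$, define edge labellings $f_+(uv)=f(u)+f(v)$ and $f_-(uv)=|f(u)-f(v)|$ for $uv\in E(G)$. The sum index $\operatorname{sum}(G)$ is the minimum, over all injective $f:V(G)\to\mathbb{Z}$, of the number of distinct values taken by $f_+$ on $E(G)$. The difference index $\operatorname{dif}(G)$ is the minimum, over all injective $f:V(G)\to\mathbb{Z}$, of the number of distinct values taken by $f_-$ on $E(G)$. For $n\geq 2k$, $\hat{K}_n^{(k,k)}$ is the graph obtained from the complete graph on $n$ vertices $v_1,\ldots,v_n$ by subdividing once (i.e. replacing the edge by a path of length two through a new vertex of degree $2$) each edge $v_iv_j$ with $i\neq j$ and $i,j\leq k$, and each edge $v_iv_j$ with $i\neq j$ and $i,j>n-k$. Thus the edges of two disjoint cliques of order $k$ are subdivided, and all other edges of the complete graph are kept. *)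

(* Defs.v *)
From HB Require Import structures.
From mathcomp Require Import all_boot all_order all_algebra.
From mathcomp Require Import boolp.

Set Implicit Arguments.
Unset Strict Implicit.
Unset Printing Implicit Defensive.

Import Order.TTheory GRing.Theory Num.Theory.
Local Open Scope ring_scope.

Record sgraph := SGraph {
  vertex :> finType;
  adj : rel vertex;
  adj_sym : symmetric adj;
  adj_irr : irreflexive adj }.

Definition edges (G : sgraph) : {set {set G}} :=
  [set [set p.1; p.2] | p in [pred p : G * G | adj p.1 p.2]].

(* Each edge occurs as two ordered pairs; phi is only used at symmetric
   operations, so both give the same label. *)
Definition edge_labels (G : sgraph) (phi : int -> int -> int) (f : G -> int) :
    seq int :=
  undup [seq phi (f p.1) (f p.2) | p in [pred p : G * G | adj p.1 p.2]].

Definition attained (G : sgraph) (phi : int -> int -> int) (m : nat) : Prop :=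
  exists2 f : G -> int, injective f & size (edge_labels phi f) = m.

Lemma attained_ex (G : sgraph) (phi : int -> int -> int) :
  exists m, `[< attained G phi m >].
Proof.
pose f (x : G) : int := (enum_rank x : nat)%:Z.
exists (size (edge_labels phi f)); apply/asboolP; exists f => // x y.
by move=> [/ord_inj]; apply: enum_rank_inj.
Qed.

Definition label_index (G : sgraph) (phi : int -> int -> int) : nat :=
  ex_minn (attained_ex G phi).

Definition sum_index (G : sgraph) : nat :=
  label_index G (fun a b => a + b).

Definition dif_index (G : sgraph) : nat :=
  label_index G (fun a b => `|a - b|).

Section Subdivision.
Variables (G : sgraph) (S : {set {set G}}).

(* inr e is the new vertex placed on the edge e; members of S that are not
   edges of G are ignored. *)
Definition subdiv_vertex : finType :=
  (G + {e : {set G} | e \in edges G :&: S})%type.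

Definition subdiv_adj (x y : subdiv_vertex) : bool :=
  match x, y with
  | inl u, inl v => adj u v && ([set u; v] \notin S)
  | inl u, inr e => u \in val e
  | inr e, inl u => u \in val e
  | inr _, inr _ => false
  end.

Lemma subdiv_sym : symmetric subdiv_adj.
Proof. by move=> [u|e] [v|e'] //=; rewrite adj_sym setUC. Qed.

Lemma subdiv_irr : irreflexive subdiv_adj.
Proof. by move=> [u|e] //=; rewrite adj_irr. Qed.

Definition subdivide : sgraph := SGraph subdiv_sym subdiv_irr.

End Subdivision.

Lemma neq_sym (T : eqType) : symmetric (fun x y : T => x != y).
Proof. by move=> x y; rewrite eq_sym. Qed.

Lemma neq_irr (T : eqType) : irreflexive (fun x y : T => x != y).
Proof. by move=> x; rewrite eqxx. Qed.

Definition complete_graph (n : nat) : sgraph :=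
  @SGraph 'I_n (fun i j => i != j) (@neq_sym _) (@neq_irr _).

(* Vertices are numbered from 0, so v_1, ..., v_k are the i < k and
   v_(n-k+1), ..., v_n are the i >= n - k. *)
Definition Khat (n k : nat) : sgraph :=
  @subdivide (complete_graph n)
    [set e : {set 'I_n} | [forall i in e, (i < k)%N]
                       || [forall i in e, (n - k <= i)%N]].

(* Main.v *)
(** Sum index: the stars at the vertices of smallest and largest label have at
    least [n - k] edges each and share at most one sum; labelling [v_i] by [i]
    and the new vertices just outside [0, n - 1] makes all sums fall into
    [k, 2n - k - 2].

    Difference index: let [m] be a vertex of neither clique, [y] the original
    vertex of largest label, [T] the subdivided clique containing [y] (or [{y}]
    if there is none), with [p] members labelled below [m] and [q] above.
    Differences along nested intervals are distinct.  Shrinking [u, y] to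
    [m, y] and then to [m, m] meets only [p] missing edges; if [z] is the lowest
    member of [T] and lies below [m], shrinking [u, y] to [z, y], then [z, m],
    then [m, m] meets only [q] of them.
    As [p + q <= k], one of the two gives [n - 1 - k/2] differences. *)
Require Import Defs.
From mathcomp Require Import all_boot all_order all_algebra.
From mathcomp Require Import boolp zify lra.

Import Order.TTheory GRing.Theory Num.Theory.
Local Open Scope ring_scope.

Lemma label_index_le (G : sgraph) phi (f : G -> int) :
  injective f -> (label_index G phi <= size (edge_labels phi f))%N.
Proof.
move=> f_inj; rewrite /label_index; case: ex_minnP => m _; apply.
by apply/asboolP; exists f.
Qed.

Lemma label_index_ge (G : sgraph) phi m :
  (forall f : G -> int, injective f -> (m <= size (edge_labels phi f))%N) ->
  (m <= label_index G phi)%N.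
Proof.
move=> lb; rewrite /label_index; case: ex_minnP => r /asboolP[f f_inj <-] _.
exact: lb.
Qed.

Lemma mem_edge_labels (G : sgraph) phi (f : G -> int) (u v : G) :
  adj u v -> phi (f u) (f v) \in edge_labels phi f.
Proof.
move=> uv; rewrite mem_undup.
by apply/imageP; exists (u, v).
Qed.

Lemma card_le_size (V : finType) (S : {set V}) (D : seq int) (h : V -> int) :
  {in S &, injective h} -> {in S, forall v, h v \in D} -> (#|S| <= size D)%N.
Proof.
move=> h_inj hD; rewrite cardE -(size_map h); apply: uniq_leq_size.
  by rewrite map_inj_in_uniq ?enum_uniq // => u v; rewrite !mem_enum; apply: h_inj.
by move=> _ /mapP[v vS ->]; apply: hD; rewrite -mem_enum.
Qed.

(** * Differences along nested intervals *)

Section Chains.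
(** In use [V] holds the original vertices, [D] the edge differences and [T] the block of [y]: [m]
    is joined to every other vertex, and members of [T] to everything outside [T]. *)
Variables (V : finType) (g : V -> int) (D : seq int) (T : {set V}) (m y : V).
Hypotheses (g_inj : injective g) (yT : y \in T) (y_max : forall v, g v <= g y).
Hypothesis mD : forall v, v != m -> `|g m - g v| \in D.
Hypothesis TD : forall u v, u \in T -> v \notin T -> `|g u - g v| \in D.

Lemma chain_through_max :
  (#|V|.-1 - #|[set v in T | g v < g m]%R| <= size D)%N.
Proof.
pose S := [set~ m] :\: [set v in T | g v < g m].
apply: (@leq_trans #|S|).
  have : (#|[set~ m] :&: [set v in T | (g v < g m)%R]|
          <= #|[set v in T | (g v < g m)%R]|)%N by rewrite subset_leq_card ?subsetIr.
  by rewrite /S cardsD cardsC1; lia.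
have ym := y_max m.
(* Vertices below [m] give values above [g y - g m], the others values at most that, so none
   repeats. *)
apply: (@card_le_size _ _ _ (fun v => if g v < g m then g y - g v else g v - g m)).
  move=> u v _ _; have := y_max u; have := y_max v.
  by case: ifP; case: ifP => ? ? ? ? ?; apply: g_inj; lia.
move=> v; rewrite !inE => /andP[+ vm]; have := y_max v; case: ifP => vltm yv.
  rewrite andbT => vT; have := TD _ _ yT vT.
  by rewrite ger0_norm ?subr_ge0.
by move=> _; have := mD _ vm; rewrite distrC ger0_norm // subr_ge0 leNgt vltm.
Qed.

Lemma chain_through_min z :
  z \in T -> (forall v, v \in T -> g z <= g v) -> g z < g m ->
  (#|V|.-1 - #|[set v in T | g m < g v]%R| <= size D)%N.
Proof.
move=> zT z_min zm; pose S := [set~ m] :\: [set v in T | g m < g v].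
apply: (@leq_trans #|S|).
  have : (#|[set~ m] :&: [set v in T | (g m < g v)%R]|
          <= #|[set v in T | (g m < g v)%R]|)%N by rewrite subset_leq_card ?subsetIr.
  by rewrite /S cardsD cardsC1; lia.
have ym := y_max m.
(* On [S] the three cases take values in disjoint ranges: above [g y - g z], in [(0, g m - g z]],
   and in [(g m - g z, g y - g z]]. *)
apply: (@card_le_size _ _ _ (fun v => if g v < g z then g y - g v
                                      else if g v < g m then g m - g v
                                      else g v - g z)).
  move=> u v; rewrite !inE => /andP[_ um] /andP[_ vm].
  have um' : g u <> g m by move/g_inj/eqP; apply/negP.
  have vm' : g v <> g m by move/g_inj/eqP; apply/negP.
  have := y_max u; have := y_max v.
  by do 4?case: ifP => ?; move=> ? ? ?; apply: g_inj; lia.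
move=> v; rewrite !inE => /andP[+ vm]; have yv := y_max v.
have vm' : g v <> g m by move/g_inj/eqP; apply/negP.
case: ifP => vz.
  move=> _; have vT : v \notin T by apply/negP => /z_min; lia.
  by have := TD _ _ yT vT; rewrite ger0_norm ?subr_ge0.
case: ifP => vltm; first by move=> _; have := mD _ vm; rewrite ger0_norm ?subr_ge0 ?ltW.
have -> : (g m < g v) = true by lia.
rewrite andbT => vT; have := TD _ _ zT vT.
by rewrite distrC ger0_norm // subr_ge0 leNgt vz.
Qed.

Lemma chain_bound : (2 * #|V|.-1 <= 2 * size D + #|T|)%N.
Proof.
have cardT : (#|[set v in T | (g v < g m)%R]|
              + #|[set v in T | (g m < g v)%R]| <= #|T|)%N.
  rewrite -cardsUI (_ : _ :&: _ = set0) ?cards0 ?addn0.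
    by rewrite subset_leq_card //; apply/subsetP => v; rewrite !inE; lia.
  by apply/setP => v; rewrite !inE; lia.
have through_max := chain_through_max.
(* With no member of [T] below [m], the first chain loses nothing; otherwise the two chain bounds
   are added. *)
have [p0|[w]] := set_0Vmem [set v in T | g v < g m].
  by move: through_max; rewrite p0 cards0; lia.
rewrite inE => /andP[wT wm].
case: (arg_minP g wT) => z zT z_min.
have zm : g z < g m by apply: le_lt_trans wm; apply: z_min.
have := chain_through_min _ zT z_min zm; lia.
Qed.

End Chains.

(** * Adjacency and the subdivided cliques *)

(* [y] together with the original vertices not adjacent to it. *)
Definition block (n k : nat) (y : 'I_n) : {set 'I_n} :=
  if (y < k)%N then [set i : 'I_n | (i < k)%N]
  else if (n - k <= y)%N then [set i : 'I_n | (n - k <= i)%N] else [set y].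

Lemma mem_block n k y : y \in block n k y.
Proof. by rewrite /block; do 2?case: ifP => ?; rewrite inE. Qed.

Lemma card_low n k : (k <= n)%N -> #|[set i : 'I_n | (i < k)%N]| = k.
Proof.
move=> kn; have widen_inj : injective (widen_ord kn) by move=> i j [/ord_inj].
rewrite -[RHS](card_ord k) -(card_imset _ widen_inj); apply: eq_card => i.
rewrite inE; apply/idP/imsetP => [ik|[j _ ->]]; last exact: (ltn_ord j).
by exists (Ordinal ik) => //; apply: ord_inj.
Qed.

Lemma card_high n k : (k <= n)%N -> #|[set i : 'I_n | (n - k <= i)%N]| = k.
Proof.
move=> kn; have -> : [set i : 'I_n | (n - k <= i)%N] = ~: [set i : 'I_n | (i < n - k)%N].
  by apply/setP => i; rewrite !inE leqNgt.
have := cardsC [set i : 'I_n | (i < n - k)%N]; rewrite card_low ?leq_subr // card_ord; lia.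
Qed.

Lemma card_block n k y : (0 < k <= n)%N -> (#|block n k y| <= k)%N.
Proof.
move=> /andP[k0 kn]; rewrite /block; case: ifP => _; first by rewrite card_low.
by case: ifP => _; rewrite ?card_high // cards1.
Qed.

Lemma Khat_adjE n k (u v : 'I_n) :
  @adj (Khat n k) (inl u) (inl v) =
  [&& u != v, ~~ ((u < k) && (v < k))%N & ~~ ((n - k <= u) && (n - k <= v))%N].
Proof.
rewrite /= inE negb_or; do 2![congr (_ && _)]; congr negb;
  apply/forall_inP/andP => [all_uv|[uP vP] i]; first
  [ by split; apply: all_uv; rewrite !inE eqxx ?orbT
  | by rewrite !inE => /orP[] /eqP ->].
Qed.

(** The cliques are disjoint when [2 * k <= n], so all members of a block have the same
    non-neighbours among the original vertices, namely the block. *)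
Lemma adj_block n k (y u v : 'I_n) : (2 * k <= n)%N ->
  u \in block n k y -> v \notin block n k y -> @adj (Khat n k) (inl u) (inl v).
Proof.
move=> kn uy vy; have uv : u != v by apply: contraNneq vy => <-.
rewrite Khat_adjE uv /=; move: uy vy.
by rewrite /block; do 2?case: ifP => ?; rewrite !inE; [lia | lia | move=> /eqP -> _; lia].
Qed.

(** * Lower bounds for arbitrary labellings *)

Lemma Khat_dif_lower n k (f : Khat n k -> int) :
  (0 < k)%N -> (2 * k < n)%N -> injective f ->
  (2 * n.-1 <= 2 * size (edge_labels (fun a b => `|a - b|%R) f) + k)%N.
Proof.
move=> k0 kn f_inj; have kltn : (k < n)%N by lia.
(* Position [k] lies in neither clique, because [k < n - k]. *)
pose m := Ordinal kltn; pose g (i : 'I_n) := f (inl i).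
have g_inj : injective g by move=> i j /f_inj [].
case: (arg_maxP g (erefl : xpredT m)) => y _ y_max.
pose D := edge_labels (fun a b => `|a - b|) f.
have mD v : v != m -> `|g m - g v| \in D.
  by move=> vm; apply: mem_edge_labels; rewrite Khat_adjE eq_sym vm /=; lia.
have TD u v : u \in block n k y -> v \notin block n k y -> `|g u - g v| \in D.
  by move=> uT vT; apply: mem_edge_labels; apply: adj_block uT vT; lia.
have := chain_bound _ _ _ _ _ _ g_inj (mem_block n k y) (fun v => y_max v isT) mD TD.
rewrite card_ord => /leq_trans; apply.
by rewrite leq_add2l card_block //; lia.
Qed.

Lemma Khat_sum_lower n k (f : Khat n k -> int) :
  (0 < k)%N -> (2 * k < n)%N -> injective f ->
  (2 * n - 2 * k - 1 <= size (edge_labels (fun a b => (a + b)%R) f))%N.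
Proof.
move=> k0 kn f_inj; have kltn : (k < n)%N by lia.
pose m := Ordinal kltn; pose g (i : 'I_n) := f (inl i).
have g_inj : injective g by move=> i j /f_inj [].
case: (arg_minP g (erefl : xpredT m)) => x _ x_min.
case: (arg_maxP g (erefl : xpredT m)) => y _ y_max.
(* Dropping [x] from [Y] removes the one sum the stars can share, [g x + g y]. *)
pose X := ~: block n k x; pose Y := ~: block n k y :\ x.
pose s := [seq g x + g v | v <- enum X] ++ [seq g y + g v | v <- enum Y].
have star_uniq z (Z : {set 'I_n}) : uniq [seq g z + g v | v <- enum Z].
  by rewrite map_inj_uniq ?enum_uniq // => u v /addrI /g_inj.
have card_star z : (n - k <= #|~: block n k z|)%N.
  have := cardsC (block n k z); rewrite card_ord.
  by have : (#|block n k z| <= k)%N; [rewrite card_block; lia | lia].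
have s_uniq : uniq s.
  rewrite cat_uniq !star_uniq andbT /=; apply/hasPn => _ /mapP[v + ->].
  rewrite mem_enum !inE => /andP[vx _]; apply/mapP => -[u _].
  (* From [g x < g v] and [g u <= g y], the sum at [y] is strictly larger. *)
  have : g v <> g x by move/g_inj/eqP; apply/negP.
  by have := x_min v isT; have := y_max u isT; rewrite /=; lia.
have s_edge : {subset s <= edge_labels (fun a b => a + b) f}.
  have star_edge z v : v \notin block n k z -> g z + g v \in edge_labels (fun a b => a + b) f.
    move=> vz; apply: (mem_edge_labels _ _ f (inl z)).
    by apply: adj_block (mem_block _ _ z) vz; lia.
  move=> l; rewrite mem_cat => /orP[] /mapP[v + ->]; rewrite mem_enum !inE.
    exact: star_edge.
  by move=> /andP[_]; apply: star_edge.
apply: leq_trans (uniq_leq_size s_uniq s_edge); rewrite size_cat !size_map -!cardE.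
apply: (@leq_trans ((n - k) + (n - k - 1))); first by lia.
apply: leq_add; first exact: card_star.
rewrite leq_subLR; apply: leq_trans (card_star y) _.
by rewrite (cardsD1 x) leq_add2r leq_b1.
Qed.

(** * A labelling with few sums *)

Definition new_vertex (n k : nat) : finType :=
  {e | e \in edges (complete_graph n) :&:
     [set e : {set 'I_n} | [forall i in e, (i < k)%N]
                       || [forall i in e, (n - k <= i)%N]]}.

Lemma Khat_sum_upper n k : ('C(k, 2) + 2 * k <= n)%N -> (1 < k)%N ->
  exists2 f : Khat n k -> int, injective f &
    (size (edge_labels (fun a b => (a + b)%R) f) <= 2 * n - 2 * k - 1)%N.
Proof.
move=> hn k1; have kn : (k <= n)%N by lia.
pose A := [set i : 'I_n | (i < k)%N]; pose B := [set i : 'I_n | (n - k <= i)%N].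
pose pairs (W : {set 'I_n}) := [set e : {set 'I_n} | e \subset W & #|e| == 2].
pose rank W (e : {set 'I_n}) := index e (enum (pairs W)).
have rank_inj W : {in pairs W &, injective (rank W)}.
  by move=> e e' eW e'W; apply: (index_inj e); rewrite mem_enum.
have rank_lt (W : {set 'I_n}) (e : {set 'I_n}) :
    #|W| = k -> e \in pairs W -> (rank W e < 'C(k, 2))%N.
  by move=> <- eW; rewrite -cards_draws cardE index_mem mem_enum.
(* Low edges get large new labels [n, n+1, ...] and high edges small ones [-1, -2, ...], which pulls
   their sums towards the middle. *)
pose f (v : Khat n k) : int := match v with
  | inl i => (i : nat)%:Z
  | inr e => if val e \subset A then (n + rank A (val e))%N%:Z
             else - (rank B (val e)).+1%:Z end.
have newP (v : new_vertex n k) :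
    if val v \subset A then val v \in pairs A else val v \in pairs B.
  case: v => e /=; rewrite in_setI => /andP[/imsetP[[i j] /= ij ->]].
  rewrite !inE cards2 (ij : i != j) eqxx !andbT.
  case: ifP => // + /orP[|] /forall_inP eP; last first.
    by move=> _; apply/subsetP => l /eP; rewrite inE.
  by move=> /negP[]; apply/subsetP => l /eP; rewrite inE.
(* The bound on [n] enters here: low edges give at most [(k - 1) + (n + 'C(k, 2) - 1)], high ones at
   least [(n - k) - 'C(k, 2)]. *)
have f_edge (i : 'I_n) (e : new_vertex n k) :
    i \in val e -> k%:Z <= f (inl i) + f (inr e) <= (2 * n - k - 2)%N%:Z.
  move=> ie; have := newP e; rewrite /f; have iltn := ltn_ord i.
  case: ifP => _ eW; have := rank_lt _ _ _ eW; rewrite ?card_low ?card_high // => /(_ erefl);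
    move: eW; rewrite inE => /andP[/subsetP /(_ i ie)];
    rewrite inE => ? _; move: (rank _ _) => r; lia.
exists f.
  move=> [i|e] [j|e'] /=.
  - by move=> [/ord_inj ->].
  - by case: ifP => _; have := ltn_ord i; lia.
  - by case: ifP => _; have := ltn_ord j; lia.
  - have := newP e; have := newP e'; case: ifP => _ e'W; case: ifP => _ eW; try lia.
      by move=> [/addnI ee']; congr inr; apply: val_inj; apply: (rank_inj A).
    by move=> /oppr_inj [ee']; congr inr; apply: val_inj; apply: (rank_inj B).
pose s := [seq (k + i)%N%:Z | i <- iota 0 (2 * n - 2 * k - 1)].
have <- : size s = (2 * n - 2 * k - 1)%N by rewrite size_map size_iota.
apply: uniq_leq_size; first exact: undup_uniq.
move=> l; rewrite mem_undup => /imageP[[u v] uv ->].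
suff /andP[lk ln] : k%:Z <= f u + f v <= (2 * n - k - 2)%N%:Z.
  apply/mapP; exists `|(f u + f v - k%:Z)%R|%N; first by rewrite mem_iota; lia.
  by rewrite /=; lia.
case: u v uv => [i|e] [j|e'] //=; rewrite inE; last 2 first.
- by move=> ie; apply: f_edge.
- by rewrite addrC; apply: f_edge.
(* One endpoint is at least [k], and one is at most [n - k - 1]. *)
rewrite [X in is_true X -> _](Khat_adjE n k i j) => /and3P[].
by have := ltn_ord i; have := ltn_ord j; lia.
Qed.

Theorem theorem3p5 (k n : nat) (hk : (2 <= k)%N)
    (hn : ('C(k, 2) + 2 * k <= n)%N) :
  [/\ (sum_index (Khat n k))%:Z = 2 * n%:Z - 2 * k%:Z - 1,
      n%:R - 2 * k%:R / 3 - 1 <= (dif_index (Khat n k))%:R :> rat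
    & n%:R - 2 * k%:R / 3 - 1
      = (Num.ceil ((sum_index (Khat n k))%:R / 2 : rat))%:~R + k%:R / 3 - 1 :> rat].
Proof.
(* Strictness leaves a vertex outside both cliques. *)
have kn : (2 * k < n)%N by have : (0 < 'C(k, 2))%N; [rewrite bin_gt0 | lia].
have sumE : sum_index (Khat n k) = (2 * n - 2 * k - 1)%N.
  apply/eqP; rewrite eqn_leq; apply/andP; split.
    have [f f_inj f_size] := Khat_sum_upper n k hn hk.
    exact: leq_trans (label_index_le _ _ _ f_inj) f_size.
  by apply: label_index_ge => f; apply: Khat_sum_lower; lia.
split; first by rewrite sumE; lia.
  have dif_ge : (n.-1 - k./2 <= dif_index (Khat n k))%N.
    by apply: label_index_ge => f /Khat_dif_lower; lia.
  (* The loss [k./2] is within the allowed [2k/3]; denominators are cleared. *)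
  have : (3 * n <= 3 * dif_index (Khat n k) + 2 * k + 3)%N by lia.
  by rewrite -(ler_nat rat) !natrD; lra.
rewrite sumE; set t := (2 * n - 2 * k - 1)%N.
(* An additive form of [t] survives the cast to [rat]; then [t / 2 = n - k - 1/2] has ceiling
   [n - k]. *)
have : (t + 2 * k + 1)%:R = (2 * n)%:R :> rat by congr _%:R; rewrite /t; lia.
rewrite !natrD => tE.
have -> : Num.ceil (t%:R / 2 : rat) = n%:Z - k%:Z.
  by apply: ceil_def; rewrite !intrB -!pmulrn; lra.
by rewrite intrB -!pmulrn; lra.
Qed.
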